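(* Let $p$ be a prime, let $S$ be a finite $p$-group, and let $\mathcal F$ be a saturated fusion system on $S$. For every monotone Borel-Smith function $f\in C_b(\mathcal F)$, there exist an integer $N\ge 1$ and an $\mathcal F$-stable rational $S$-representation $V$ such that $\mathrm{Dim}\,V=Nf$, i.e. $\dim_{\mathbb Q}V^H=N f(H)$ for every subgroup $H\le S$.
   Context: A fusion system $\mathcal F$ on a finite $p$-group $S$ is a category whose objects are the subgroups of $S$ and whose morphism sets $\mathcal F(P,Q)$ satisfy: $\mathrm{Hom}_S(P,Q)\subseteq \mathcal F(P,Q)\subseteq \mathrm{Inj}(P,Q)$, where $\mathrm{Inj}(P,Q)$ is the set of injective group homomorphisms and $\mathrm{Hom}_S(P,Q)$ the set of homomorphisms induced by conjugation by elements of $S$; and every $\varphi\in\mathcal F(P,Q)$ factors in $\mathcal F$ as $P\xrightarrow{\varphi}\varphi P\hookrightarrow Q$ with $\varphi^{-1}\colon\varphi P\to P$ also in $\mathcal F$. Subgroups (or elements) are $\mathcal F$-conjugate if connected by an isomorphism in $\mathcal F$. $P\le S$ is fully $\mathcal F$-centralized (resp. fully $\mathcal F$-normalized) if $|C_S(P)|\ge|C_S(P')|$ (resp. $|N_S(P)|\ge|N_S(P')|$) for all $P'$ $\mathcal F$-conjugate to $P$. $\mathcal F$ is saturated if: (1) every fully $\mathcal F$-normalized $P$ is fully $\mathcal F$-centralized and $\mathrm{Aut}_S(P)$ is a Sylow $p$-subgroup of $\mathrm{Aut}_{\mathcal F}(P)$; (2) if $\varphi\in\mathcal F(P,S)$ has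 fully $\mathcal F$-centralized image, then $\varphi$ extends to some $\tilde\varphi\in\mathcal F(N_\varphi,S)$, where $N_\varphi=\{x\in N_S(P)\mid \exists y\in N_S(\varphi P)\colon \varphi\circ c_x=c_y\circ\varphi\}$. A rational $S$-representation is a finite-dimensional $\mathbb Q S$-module. An $S$-representation $V$ is $\mathcal F$-stable if $\mathrm{res}_\varphi V\cong\mathrm{res}^S_P V$ for all $P\le S$ and $\varphi\in\mathcal F(P,S)$, where $\mathrm{res}_\varphi V$ is $V$ with $P$ acting by $x\cdot v=\varphi(x)v$. For a finite group $G$, a super class function on $G$ is a function from the set of subgroups of $G$ to $\mathbb Z$ that is constant on $G$-conjugacy classes. It is a Borel-Smith function if: (i) whenever $L\lhd H\le G$, $H/L\cong\mathbb Z/q$ with $q$ an odd prime, $f(L)-f(H)$ is even; (ii) whenever $L\lhd H\le G$, $H/L\cong\mathbb Z/q\times\mathbb Z/q$ with $q$ prime, and $H_i/L$ ($0\le i\le q$) are all the subgroups of order $q$ of $H/L$, $f(L)-f(H)=\sum_{i=0}^q (f(H_i)-f(H))$; (iii) whenever $L\lhd H\lhd N\le N_G(L)$ and $H/L\cong\mathbb Z/2$, $f(L)-f(H)$ is even if $N/L\cong\mathbb Z/4$, and $f(L)-f(H)$ is divisible by $4$ if $N/L$ is the quaternion group $Q_8$ of order $8$. $C_b(\mathcal F)$ is the group of Borel-Smith functions on $S$ that are constant on $\mathcal F$-conjugacy classes of subgroups of $S$. A function $f\in C_b(\mathcal F)$ is monotone if $f(K)\ge f(H)\ge 0$ for all $K\le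 H\le S$. *)

(* Defs.v *)
From mathcomp Require Import all_boot all_order all_algebra.
From mathcomp Require Import all_fingroup all_solvable all_field all_character.

Set Implicit Arguments.
Unset Strict Implicit.
Unset Printing Implicit Defensive.

Import GroupScope.

(* A morphism P -> Q is a group morphism defined on P, whose values outside P
   are irrelevant (fus_eq).  Only the values of fus_hom at subgroups of S are
   constrained: these are the objects of the category.  Conjugation is on the
   right, u ^ x = x^-1 * u * x, as everywhere in the library; the set Hom_S(P, Q)
   does not depend on this choice.  Identities and inclusions are the case
   s = 1 of fus_conj. *)
Record fusion_system (gT : finGroupType) (S : {group gT}) := FusionSystem {
  fus_hom : forall P Q : {group gT}, pred {morphism P >-> gT};
  fus_eq : forall (P Q : {group gT}) (phi psi : {morphism P >-> gT}),
    P \subset S -> Q \subset S -> {in P, phi =1 psi} ->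
    fus_hom Q phi -> fus_hom Q psi;
  fus_inj : forall (P Q : {group gT}) (phi : {morphism P >-> gT}),
    P \subset S -> Q \subset S -> fus_hom Q phi ->
    'injm phi /\ phi @* P \subset Q;
  fus_conj : forall (P Q : {group gT}) (s : gT),
    P \subset S -> Q \subset S -> s \in S -> P :^ s \subset Q ->
    fus_hom Q [morphism of conjgm P s];
  fus_comp : forall (P Q R : {group gT}) (phi : {morphism P >-> gT})
      (psi : {morphism Q >-> gT}) (chi : {morphism P >-> gT}),
    P \subset S -> Q \subset S -> R \subset S ->
    fus_hom Q phi -> fus_hom R psi -> {in P, chi =1 psi \o phi} ->
    fus_hom R chi;
  fus_img : forall (P Q : {group gT}) (phi : {morphism P >-> gT}),
    P \subset S -> Q \subset S -> fus_hom Q phi ->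
    fus_hom (phi @* P)%G phi;
  fus_inv : forall (P Q : {group gT}) (phi : {morphism P >-> gT})
      (injphi : 'injm phi),
    P \subset S -> Q \subset S -> fus_hom Q phi ->
    @fus_hom (phi @* P)%G P [morphism of invm injphi]
}.

Section Fusion.

Variables (gT : finGroupType) (S : {group gT}) (F : fusion_system S).

Definition fus_conjugate (P Q : {group gT}) : Prop :=
  exists (phi : {morphism P >-> gT}) (psi : {morphism Q >-> gT}),
    [/\ fus_hom F Q phi, fus_hom F P psi,
        {in P, cancel phi psi} & {in Q, cancel psi phi}].

Definition fully_centralized (P : {group gT}) : Prop :=
  forall P' : {group gT}, P' \subset S -> fus_conjugate P P' ->
    #|'C_S(P')| <= #|'C_S(P)|.

Definition fully_normalized (P : {group gT}) : Prop :=
  forall P' : {group gT}, P' \subset S -> fus_conjugate P P' ->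
    #|'N_S(P')| <= #|'N_S(P)|.

(* Automorphisms of P are the elements of the permutation group Aut P. *)
Definition fus_Aut (P : {group gT}) : {set {perm gT}} :=
  [set a | match @idP (a \in Aut P) with
           | ReflectT AutPa => fus_hom F P [morphism of autm AutPa]
           | ReflectF _ => false
           end].

(* conj_aut P restricts the conjugation by an element of 'N(P) to P. *)
Definition fus_AutS (P : {group gT}) : {set {perm gT}} := conj_aut P @* 'N_S(P).

Definition fus_N (P : {group gT}) (phi : {morphism P >-> gT}) : {set gT} :=
  [set x in 'N_S(P) | [exists y in 'N_S(phi @* P),
                        [forall u in P, phi (u ^ x) == phi u ^ y]]].

Lemma fus_N_group_set (P : {group gT}) (phi : {morphism P >-> gT}) :
  group_set (fus_N phi).
Proof.
apply/group_setP; split=> [|x1 x2].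
  rewrite inE group1; apply/exists_inP; exists 1; first exact: group1.
  by apply/forall_inP=> u _; rewrite !conjg1.
rewrite !inE => /andP[Nx1 /exists_inP[y1 Ny1 /forall_inP E1]].
case/andP=> Nx2 /exists_inP[y2 Ny2 /forall_inP E2].
have {}Nx1 : x1 \in 'N_S(P) by rewrite !inE.
have {}Nx2 : x2 \in 'N_S(P) by rewrite !inE.
have := groupM Nx1 Nx2; rewrite !inE => -> /=.
apply/exists_inP; exists (y1 * y2); first exact: groupM.
apply/forall_inP=> u Pu; rewrite !conjgM.
case/setIP: Nx1 => _ Nx1.
by rewrite (eqP (E2 _ _)) ?memJ_norm // (eqP (E1 _ Pu)).
Qed.

Canonical fus_N_group P phi := Group (@fus_N_group_set P phi).

Definition saturated (p : nat) : Prop :=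
  (forall P : {group gT}, P \subset S -> fully_normalized P ->
     fully_centralized P /\ p.-Sylow(fus_Aut P) (fus_AutS P)) /\
  (forall (P : {group gT}) (phi : {morphism P >-> gT}),
     P \subset S -> fus_hom F S phi -> fully_centralized (phi @* P)%G ->
     exists phi' : {morphism fus_N_group phi >-> gT},
       fus_hom F S phi' /\ {in P, phi' =1 phi}).

Lemma fus_hom_pre (P : {group gT}) (phi : {morphism P >-> gT}) :
  P \subset S -> fus_hom F S phi -> P \subset phi @*^-1 S.
Proof.
by move=> sPS /(fus_inj sPS (subxx _))[_ imS]; rewrite -sub_morphim_pre.
Qed.

Definition fus_res n (V : mx_representation rat S n) (P : {group gT})
    (phi : {morphism P >-> gT}) (sPS : P \subset S) (Fphi : fus_hom F S phi) :
    mx_representation rat P n :=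
  subg_repr (morphpre_repr phi V) (fus_hom_pre sPS Fphi).

Definition fus_stable n (V : mx_representation rat S n) : Prop :=
  forall (P : {group gT}) (phi : {morphism P >-> gT})
    (sPS : P \subset S) (Fphi : fus_hom F S phi),
    mx_rsim (fus_res V sPS Fphi) (subg_repr V sPS).

End Fusion.

Section BorelSmith.

Local Open Scope ring_scope.

Variables (gT : finGroupType) (G : {group gT}) (f : {group gT} -> int).

(* Only the values of f at subgroups of G matter. *)
Definition super_class_function : Prop :=
  forall (H : {group gT}) (x : gT), H \subset G -> x \in G -> f (H :^ x)%G = f H.

Definition borel_smith : Prop :=
  [/\ super_class_function,
      forall (q : nat) (L H : {group gT}), prime q -> odd q ->
        L <| H -> H \subset G -> (H / L)%g \isog [set: 'Z_q] ->
        (2 %| f L - f H)%Z,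
      forall (q : nat) (L H : {group gT}), prime q ->
        L <| H -> H \subset G -> (H / L)%g \isog [set: 'Z_q * 'Z_q] ->
        f L - f H = \sum_(K : {group gT} |
          [&& L \subset K, K \subset H & #|(K / L)%g| == q]) (f K - f H)
    & forall L H N : {group gT},
        L <| H -> H <| N -> N \subset 'N_G(L) -> (H / L)%g \isog [set: 'Z_2] ->
        ((N / L)%g \isog [set: 'Z_4] -> (2 %| f L - f H)%Z) /\
        ((N / L)%g \isog 'Q_8 -> (4 %| f L - f H)%Z)].

Definition monotone_on : Prop :=
  forall K H : {group gT}, K \subset H -> H \subset G -> 0 <= f H <= f K.

End BorelSmith.

Definition fus_invariant (gT : finGroupType) (S : {group gT})
    (F : fusion_system S) (f : {group gT} -> int) : Prop :=
  forall P Q : {group gT}, P \subset S -> Q \subset S ->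
    fus_conjugate F P Q -> f P = f Q.

(* Main.v *)
Require Import Defs.
From mathcomp Require Import all_boot all_order all_algebra.
From mathcomp Require Import all_fingroup all_solvable all_field all_character.
From mathcomp Require Import ring.

Set Implicit Arguments.
Unset Strict Implicit.
Unset Printing Implicit Defensive.

Import GroupScope Order.TTheory GRing.Theory Num.Theory.

(** A rational character phi of S takes the same value at all generators of a
    cyclic group, so it can be recovered from its dimension function d on cyclic
    subgroups: for a p-group the Moebius inversion collapses to
      phi x = (p d<x> - d<x^p>) / (p - 1).
    Applied to f in place of d, this formula defines a class function phi
    (rational_transform), and the theorem amounts to three facts about it.

    1. Averaging phi over H gives f H for every H <= S, and not only for H
       cyclic (sum_rational_transform).  A noncyclic p-group H has a normal
       subgroup L with H / L = Z/p x Z/p; the Borel-Smith condition for H / L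
       expresses f H through the values of f at smaller subgroups, and averages
       of phi obey the same recursion because H is covered by the p + 1
       subgroups between L and H, which meet pairwise in L.

    2. A positive multiple of phi is the character of a rational representation
       (rational_transform_afforded).  An irreducible chi of a p-group is induced
       from a linear character lambda of some T <= S (pgroup_irr_monomial).  As
       phi is constant on generators of cyclic groups, lambda may be replaced in
       '[phi, chi] = '[phi, lambda]_T by its average over the power maps
       x |-> x ^ k with k prime to p.  With P = ker lambda and Q = ker lambda^p,
       this average is (p 1_P - 1_Q) / (p - 1).  Thus '[phi, chi] is a nonnegative
       multiple of f P - f Q, which is nonnegative by monotonicity (or it is
       f T >= 0 if lambda = 1), and the average of chi over the power maps is a
       positive multiple of Ind_P^S 1 - Ind_Q^S 1, the character of a complement
       of the rational permutation module on S / Q inside the one on S / P (or of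
       Ind_T^S 1 if lambda = 1).  Averaging phi = \sum '[phi, chi] chi over
       the power maps therefore writes phi as a nonnegative rational combination
       of characters of rational representations.

    3. If V affords N phi, then the dimension of V^H is N times the average of
       phi over H, which is N f H (mxrank_rfix).  For theta in F(P, S), theta maps
       <x> onto an F-conjugate subgroup, so phi (theta x) = phi x: the two
       restrictions of V to P have the same character, and over the rationals
       this makes them isomorphic (mx_rsim_of_trace). *)

(** * Traces of idempotents, and dimensions of fixed spaces *)

Section IdempotentMatrices.

Local Open Scope ring_scope.

Variable F : fieldType.

(** The factorization of E through its image; it turns an idempotent into an
    honest pair of inclusion and projection matrices. *)
Lemma idempotent_factor n (E : 'M[F]_n) : E *m E = E ->
  exists (C : 'M_(n, \rank E)) (R : 'M_(\rank E, n)),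
    C *m R = E /\ R *m C = 1%:M.
Proof.
move=> idE; exists (col_base E), (row_base E); rewrite mulmx_base; split=> //.
apply: (row_free_inj (row_base_free E)).
apply: (row_full_inj (col_base_full E)).
by rewrite mul1mx mulmx_base mulmxA mulmxA mulmx_base -mulmxA mulmx_base.
Qed.

Lemma mxrank_idempotent n (E : 'M[F]_n) : E *m E = E -> (\rank E)%:R = \tr E.
Proof.
move=> /idempotent_factor[C [R [defE RC]]].
by rewrite -[in RHS]defE mxtrace_mulC RC mxtrace1.
Qed.

Variables (gT : finGroupType) (G : {group gT}).

(** An idempotent commuting with G cuts out a subrepresentation, whose character
    can be read off in the ambient space. *)
Lemma idempotent_image_repr n (rG : mx_representation F G n) (E : 'M[F]_n) :
    E *m E = E -> {in G, forall x, E *m rG x = rG x *m E} ->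
  exists W : representation F G, {in G, forall x, \tr (W x) = \tr (E *m rG x)}.
Proof.
move=> idE cGE; have [C [R [defE RC]]] := idempotent_factor idE.
have reprE : mx_repr G (fun x => R *m rG x *m C).
  split=> [|x y Gx Gy] /=; first by rewrite repr_mx1 mulmx1 RC.
  have mulCR m (B : 'M_(n, m)) : C *m (R *m B) = E *m B by rewrite mulmxA defE.
  rewrite repr_mxM // -!mulmxA mulCR [E *m _]mulmxA cGE //.
  by rewrite -(mulmxA _ E) -[E *m C](mulCR _ C) RC mulmx1.
exists (Representation (MxRepresentation reprE)) => x Gx /=.
by rewrite mxtrace_mulC mulmxA defE.
Qed.

End IdempotentMatrices.

Section FixedSpace.

Local Open Scope ring_scope.

Variables (gT : finGroupType) (G H : {group gT}).

(** Averaging over H is a projection onto the fixed space, so its trace is the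
    dimension of that space. *)
Lemma mxrank_rfix n (rG : mx_representation rat G n) : H \subset G ->
  #|H|%:R * (\rank (rfix_mx rG H))%:R = \sum_(h in H) \tr (rG h).
Proof.
move=> sHG; have nzH : #|H|%:R != 0 :> rat by rewrite pnatr_eq0 -lt0n cardG_gt0.
pose E := #|H|%:R^-1 *: \sum_(h in H) rG h.
have Efix : (E <= rfix_mx rG H)%MS.
  apply/rfix_mxP=> h Hh; rewrite -scalemxAl mulmx_suml; congr (_ *: _).
  rewrite [RHS](reindex_inj (mulIg h)); apply: eq_big => x; first by rewrite groupMr.
  by move=> Hx; rewrite repr_mxM ?(subsetP sHG).
have fixE (m : nat) (A : 'M_(m, n)) : (A <= rfix_mx rG H)%MS -> A *m E = A.
  move=> /rfix_mxP fixA; rewrite -scalemxAr mulmx_sumr (eq_bigr _ fixA).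
  by rewrite sumr_const -scaler_nat scalerA mulVf ?scale1r.
have eqE : (E == rfix_mx rG H)%MS.
  by rewrite Efix -{1}(fixE _ _ (submx_refl _)) submxMl.
rewrite -(eqmxP eqE) mxrank_idempotent; last exact: fixE.
by rewrite mxtraceZ mulrA mulfV // mul1r raddf_sum.
Qed.

End FixedSpace.

(** * Rational representations affording Ind 1_P and Ind 1_P - Ind 1_Q *)

Section InducedTrivial.

Local Open Scope ring_scope.

Variables (gT : finGroupType) (S : {group gT}).

(** Endomorphisms of the space of functions on S, given by their kernel. *)
Definition kernel_mx (K : gT -> gT -> rat) : 'M[rat]_#|S| :=
  \matrix_(i, j) K (enum_val i) (enum_val j).

Lemma mul_kernel_mx K L :
  kernel_mx K *m kernel_mx L
  = kernel_mx (fun a c => \sum_(b in S) K a b * L b c).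
Proof.
apply/matrixP=> i k; rewrite !mxE [in RHS]big_enum_val /=.
by apply: eq_bigr => j _; rewrite !mxE.
Qed.

Lemma eq_kernel_mx K L :
  {in S &, forall a b, K a b = L a b} -> kernel_mx K = kernel_mx L.
Proof. by move=> eqKL; apply/matrixP=> i j; rewrite !mxE eqKL ?enum_valP. Qed.

Lemma mxtrace_kernel K : \tr (kernel_mx K) = \sum_(a in S) K a a.
Proof. by rewrite big_enum_val; apply: eq_bigr => i _; rewrite mxE. Qed.

Definition translation_mx x := kernel_mx (fun a b => (b == a * x)%g%:R).

Lemma translation_mx_repr : mx_repr S translation_mx.
Proof.
split=> [|x y Sx Sy].
  apply/matrixP=> i j; rewrite !mxE mulg1 (inj_eq enum_val_inj).
  by rewrite eq_sym.
rewrite mul_kernel_mx; apply: eq_kernel_mx => a c Sa Sc.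
rewrite (bigD1 (a * x)%g (groupM Sa Sx)) /= eqxx mul1r mulgA.
rewrite big1 ?addr0 // => b /andP[_ /negPf->]; exact: mul0r.
Qed.

Definition translation_repr := MxRepresentation translation_mx_repr.

(** The projection of the regular representation onto the functions that are
    constant on the right cosets of P; this image is the permutation
    representation on S / P. *)
Definition coset_mx (P : {group gT}) :=
  kernel_mx (fun a b => #|P|%:R^-1 * (a * b^-1 \in P)%g%:R).

Lemma coset_mxC (P : {group gT}) x : x \in S ->
  coset_mx P *m translation_mx x = translation_mx x *m coset_mx P.
Proof.
move=> Sx; rewrite !mul_kernel_mx; apply: eq_kernel_mx => a c Sa Sc.
rewrite (bigD1 (c * x^-1)%g (groupM Sc (groupVr Sx))) /= mulgKV eqxx mulr1.
rewrite big1 => [|b /andP[_ nb]]; last first.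
  by rewrite -(can2_eq (mulgKV x) (mulgK x)) eq_sym (negPf nb) mulr0.
rewrite (bigD1 (a * x)%g (groupM Sa Sx)) /= eqxx mul1r.
rewrite big1 => [|b /andP[_ /negPf->]]; last by rewrite mul0r.
by rewrite invMg invgK mulgA.
Qed.

Lemma mul_coset_mxl (P Q : {group gT}) : P \subset Q -> Q \subset S ->
  coset_mx P *m coset_mx Q = coset_mx Q.
Proof.
move=> sPQ sQS; have sPS := subset_trans sPQ sQS.
rewrite mul_kernel_mx; apply: eq_kernel_mx => a c Sa Sc.
have nzP : #|P|%:R != 0 :> rat by rewrite pnatr_eq0 -lt0n cardG_gt0.
rewrite (reindex_inj (inj_comp (mulIg a) invg_inj)) /=.
rewrite (bigID (mem P)) /= [X in _ + X]big1 => [|b /andP[_ /negPf nPb]]; last first.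
  by rewrite invMg invgK mulKVg nPb mulr0 mul0r.
rewrite (eq_bigr (fun=> #|P|%:R^-1 * (#|Q|%:R^-1 * (a * c^-1 \in Q)%g%:R))).
  rewrite addr0 (eq_bigl (mem P)) => [|b]; last first.
    apply: andb_idl => /(subsetP sPS) Sb; by rewrite groupM ?groupV.
  by rewrite sumr_const -[LHS]mulr_natl mulrA mulfV // mul1r.
move=> b /andP[_ Pb]; rewrite invMg invgK mulKVg Pb mulr1 -mulgA.
by rewrite groupMl // groupV (subsetP sPQ).
Qed.

Lemma mul_coset_mxr (P Q : {group gT}) : P \subset Q -> Q \subset S ->
  coset_mx Q *m coset_mx P = coset_mx Q.
Proof.
move=> sPQ sQS; apply: trmx_inj; rewrite trmx_mul.
have trC (R : {group gT}) : (coset_mx R)^T = coset_mx R.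
  by apply/matrixP=> i j; rewrite !mxE -groupV invMg invgK.
by rewrite !trC mul_coset_mxl.
Qed.

(** The value at y of the character of S induced from the trivial character
    of P, as a rational number. *)
Definition cfind1 (P : {group gT}) (y : gT) : rat :=
  #|P|%:R^-1 * \sum_(u in S) (y ^ u \in P)%g%:R.

Lemma mxtrace_coset (P : {group gT}) x :
  x \in S -> \tr (coset_mx P *m translation_mx x) = cfind1 P x.
Proof.
move=> Sx; rewrite mul_kernel_mx mxtrace_kernel /cfind1 mulr_sumr.
rewrite (reindex_inj invg_inj) /=; apply: eq_big => [a|a]; rewrite groupV // => Sa.
rewrite (bigD1 (a^-1 * x^-1)%g (groupM (groupVr Sa) (groupVr Sx))) /= mulgKV eqxx mulr1.
rewrite big1 ?addr0 => [|b /andP[_ nb]]; last first.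
  by rewrite -(can2_eq (mulgKV x) (mulgK x)) eq_sym (negPf nb) mulr0.
by rewrite invMg !invgK conjgE mulgA.
Qed.

Lemma cfind1_repr (P : {group gT}) : P \subset S ->
  exists W : representation rat S, {in S, forall x, \tr (W x) = cfind1 P x}.
Proof.
move=> sPS.
have [||W trW] := idempotent_image_repr (rG := translation_repr) (E := coset_mx P).
- exact: mul_coset_mxl.
- by move=> x; apply: coset_mxC.
by exists W => x Sx; rewrite trW ?mxtrace_coset.
Qed.

(** For P <= Q the functions constant on the cosets of Q form a direct summand of
    those constant on the cosets of P, and the difference of the two projections
    is the projection onto a complement. *)
Lemma cfind1_diff_repr (P Q : {group gT}) : P \subset Q -> Q \subset S ->
  exists W : representation rat S,
    {in S, forall x, \tr (W x) = cfind1 P x - cfind1 Q x}.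
Proof.
move=> sPQ sQS; have sPS := subset_trans sPQ sQS.
have [||W trW] := idempotent_image_repr (rG := translation_repr)
  (E := coset_mx P - coset_mx Q).
- rewrite mulmxBr !mulmxBl (mul_coset_mxl (subxx P) sPS).
  rewrite (mul_coset_mxr sPQ sQS) (mul_coset_mxl sPQ sQS).
  by rewrite (mul_coset_mxl (subxx Q) sQS) subrr subr0.
- by move=> x Sx; rewrite mulmxBl mulmxBr /= !coset_mxC.
by exists W => x Sx; rewrite trW // mulmxBl raddfB /= !mxtrace_coset.
Qed.

End InducedTrivial.

(** * Rational representations with the same character are isomorphic *)

Section TraceDeterminesRepresentation.

Local Open Scope ring_scope.

Variables (gT : finGroupType) (G : {group gT}).

Definition intertwines n1 n2 (r1 : mx_representation rat G n1)
    (r2 : mx_representation rat G n2) (A : 'M[rat]_(n1, n2)) : Prop :=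
  {in G, forall x, r1 x *m A = A *m r2 x}.

Definition transfer_mx n1 n2 (r1 : mx_representation rat G n1)
    (r2 : mx_representation rat G n2) (X : 'M[rat]_(n1, n2)) : 'M[rat]_(n1, n2) :=
  \sum_(x in G) r1 x^-1%g *m X *m r2 x.

Lemma transfer_intertwines n1 n2 (r1 : mx_representation rat G n1)
    (r2 : mx_representation rat G n2) X :
  intertwines r1 r2 (transfer_mx r1 r2 X).
Proof.
move=> x Gx; rewrite mulmx_suml mulmx_sumr [LHS](reindex_inj (mulIg x)) /=.
apply: eq_big => y; first by rewrite groupMr.
rewrite groupMr // => Gy; rewrite invMg !repr_mxM ?groupV // !mulmxA.
by rewrite -[r1 x *m _]repr_mxM ?groupV // mulgV repr_mx1 mul1mx.
Qed.

(** This sum is #|G| times the squared norm of the character of W. *)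
Lemma char_pairing_neq0 (W : representation rat G) : (0 < rdegree W)%N ->
  \sum_(x in G) \tr (W x^-1%g) * \tr (W x) != 0.
Proof.
move=> W_gt0; pose chi := cfRepr (map_repr (ratr : rat -> algC) W).
have chiE x : x \in G -> chi x = ratr (\tr (W x)).
  by move=> Gx; rewrite cfunE Gx map_reprE trace_map_mx.
have nz_chi : chi != 0.
  apply: contraTneq W_gt0 => chi0; rewrite -leqNgt leqn0 -(eqr_nat algC).
  by rewrite -(cfRepr1 (map_repr (ratr : rat -> algC) W)) -/chi chi0 cfunE.
apply: contraNneq nz_chi => sum0; rewrite -cfnorm_eq0 cfdotE.
rewrite (_ : \sum_(x in G) _ = ratr (\sum_(x in G) \tr (W x^-1%g) * \tr (W x))).
  by rewrite sum0 rmorph0 mulr0.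
rewrite rmorph_sum; apply: eq_bigr => x Gx.
by rewrite -char_inv ?cfRepr_char // !chiE ?groupV // -rmorphM mulrC.
Qed.

Lemma mulmx_delta_entry m n p q (B : 'M[rat]_(m, n)) (C : 'M_(p, q)) k i j l :
  (B *m delta_mx i j *m C) k l = B k i * C j l.
Proof.
rewrite -(mul_delta_mx (0 : 'I_1)) mulmxA -mulmxA -colE -rowE.
by rewrite mxE big_ord1 !mxE.
Qed.

Section Enlarge.

Variables (n1 n2 : nat).
Variables (r1 : mx_representation rat G n1) (r2 : mx_representation rat G n2).

(** Averaging an arbitrary generalized inverse of A: the form that Maschke's
    theorem takes for homomorphisms. *)
Lemma intertwines_pinv A : intertwines r1 r2 A ->
  exists2 B, intertwines r2 r1 B & A *m B *m A = A.
Proof.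
move=> homA.
have [P APA] : exists P, A *m P *m A = A by exists (pinvmx A); rewrite mulmxKpV.
have nzG : #|G|%:R != 0 :> rat by rewrite pnatr_eq0 -lt0n cardG_gt0.
exists (#|G|%:R^-1 *: transfer_mx r2 r1 P) => [x Gx|].
  by rewrite -scalemxAr -scalemxAl transfer_intertwines.
rewrite -scalemxAr -scalemxAl mulmx_sumr mulmx_suml.
rewrite (eq_bigr (fun=> A)) => [|x Gx].
  by rewrite sumr_const -scaler_nat scalerA mulVf ?scale1r.
rewrite !mulmxA -homA ?groupV // -!mulmxA (homA x Gx).
rewrite (mulmxA P) (mulmxA A) (mulmxA A P) APA -(homA x Gx) mulmxA.
by rewrite -repr_mxM ?groupV // mulVg repr_mx1 mul1mx.
Qed.

(** If the images of E1 and E2 have the same nonzero character psi, there is a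
    nonzero homomorphism between them: were it zero for every elementary matrix
    X, adding up over all X the entry at the position where X is 1 would give
    \sum_x psi(x^-1) psi(x) = 0. *)
Lemma nonzero_intertwiner (E1 : 'M_n1) (E2 : 'M_n2) :
    E1 *m E1 = E1 -> intertwines r1 r1 E1 -> intertwines r2 r2 E2 ->
    {in G, forall x, \tr (E1 *m r1 x) = \tr (E2 *m r2 x)} -> E1 != 0 ->
  exists X, E1 *m transfer_mx r1 r2 X *m E2 != 0.
Proof.
move=> idE1 homE1 homE2 eq_tr nzE1.
pose d i j : 'M[rat]_(n1, n2) := E1 *m transfer_mx r1 r2 (delta_mx i j) *m E2.
have [/existsP[i /existsP[j nzX]] | ] := boolP [exists i, exists j, d i j != 0].
  by exists (delta_mx i j).
move/existsPn=> d0; suff []: False.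
have {}d0 i j : d i j = 0.
  by have /existsPn/(_ j)/negPn/eqP := d0 i.
have [|W trW] := idempotent_image_repr (rG := r1) idE1.
  by move=> x Gx; rewrite homE1.
have degW : (0 < rdegree W)%N.
  rewrite lt0n -(eqr_nat rat) -(mxtrace1 rat) -(repr_mx1 W) trW ?group1 //.
  by rewrite repr_mx1 mulmx1 -mxrank_idempotent // pnatr_eq0 mxrank_eq0.
have /eqP[] := char_pairing_neq0 degW.
transitivity (\sum_i \sum_j d i j i j); last first.
  by apply: big1 => i _; apply: big1 => j _; rewrite d0 mxE.
rewrite (eq_bigr (fun x => \sum_i \sum_j (E1 *m r1 x^-1%g) i i * (r2 x *m E2) j j)).
  rewrite exchange_big; apply: eq_bigr => i _; rewrite exchange_big.
  apply: eq_bigr => j _; rewrite /d mulmx_sumr mulmx_suml summxE.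
  apply: eq_bigr => x Gx.
  by rewrite -!mulmxA (mulmxA E1) (mulmxA (E1 *m _)) mulmx_delta_entry.
move=> x Gx; rewrite !trW ?groupV // (eq_tr x Gx) -homE2 //.
by rewrite /mxtrace mulr_suml; apply: eq_bigr => i _; rewrite mulr_sumr.
Qed.

(** The kernel of A and a complement of its image have the same character, so a
    nonzero homomorphism between them can be added to A. *)
Lemma intertwiner_rank_lt A : intertwines r1 r2 A ->
    {in G, forall x, \tr (r1 x) = \tr (r2 x)} -> (\rank A < n1)%N ->
  exists2 A', intertwines r1 r2 A' & (\rank A < \rank A')%N.
Proof.
move=> homA eq_tr ltAn; have [B homB ABA] := intertwines_pinv homA.
pose E1 := 1%:M - A *m B; pose E2 := 1%:M - B *m A.
have E1A : E1 *m A = 0 by rewrite mulmxBl mul1mx ABA subrr.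
have AE2 : A *m E2 = 0 by rewrite mulmxBr mulmx1 mulmxA ABA subrr.
have homE1 : intertwines r1 r1 E1.
  move=> x Gx; rewrite mulmxBr mulmxBl mulmx1 mul1mx mulmxA homA //.
  by rewrite -mulmxA homB // mulmxA.
have homE2 : intertwines r2 r2 E2.
  move=> x Gx; rewrite mulmxBr mulmxBl mulmx1 mul1mx mulmxA homB //.
  by rewrite -mulmxA homA // mulmxA.
have idE1 : E1 *m E1 = E1 by rewrite {2}/E1 mulmxBr mulmxA E1A mul0mx mulmx1 subr0.
have idE2 : E2 *m E2 = E2.
  by rewrite {1}/E2 mulmxBl -mulmxA AE2 mulmx0 mul1mx subr0.
have nzE1 : E1 != 0.
  apply: contraTneq ltAn => /eqP; rewrite subr_eq0 => /eqP AB1.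
  by rewrite -leqNgt -[X in (X <= _)%N](mxrank1 rat) AB1 mxrankM_maxl.
have [x Gx|X] := nonzero_intertwiner idE1 homE1 homE2 _ nzE1.
  rewrite !mulmxBl !mul1mx !raddfB /= eq_tr //; congr (_ - _).
  by rewrite -(mulmxA A B) -homB // mulmxA mxtrace_mulC mulmxA.
set C := E1 *m _ *m E2 => nzC.
have homC : intertwines r1 r2 C.
  move=> x Gx; rewrite !mulmxA homE1 // -(mulmxA E1) transfer_intertwines //.
  by rewrite mulmxA -(mulmxA _ (r2 x)) homE2 // mulmxA.
exists (A + C) => [x Gx|]; first by rewrite mulmxDr mulmxDl homA // homC.
have E1C : E1 *m C = C by rewrite !mulmxA idE1.
have CE2 : C *m E2 = C by rewrite -mulmxA idE2.
have sCD : (C <= (A + C)%R)%MS.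
  by apply/submxP; exists E1; rewrite mulmxDr E1A E1C add0r.
have sAD : (A <= (A + C)%R)%MS.
  by rewrite -[A in (A <= _)%MS](addrK C) addmx_sub ?eqmx_opp.
have tiAC : (A :&: C = 0)%MS.
  apply/eqP; rewrite -submx0; apply/rV_subP=> v; rewrite sub_capmx.
  case/andP=> /submxP[a va] /submxP[c vc].
  by rewrite vc -CE2 mulmxA -vc va -mulmxA AE2 mulmx0 sub0mx.
apply: (@leq_trans (\rank (A + C)%MS)).
  rewrite mxrank_disjoint_sum // -addn1 leq_add2l lt0n mxrank_eq0 //.
by apply: mxrankS; rewrite addsmx_sub sAD.
Qed.

Lemma mx_rsim_of_trace :
  {in G, forall x, \tr (r1 x) = \tr (r2 x)} -> mx_rsim r1 r2.
Proof.
move=> eq_tr; have eqn : n1 = n2.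
  apply/eqP; rewrite -(eqr_nat rat) -!(mxtrace1 rat).
  by rewrite -(repr_mx1 r1) -(repr_mx1 r2) eq_tr.
suff [A homA freeA] : exists2 A, intertwines r1 r2 A & row_free A by exists A.
suff IH k A : intertwines r1 r2 A -> (n1 <= \rank A + k)%N ->
    exists2 A, intertwines r1 r2 A & row_free A.
  by apply: (IH n1 0); rewrite ?leq_addl // => x Gx; rewrite mulmx0 mul0mx.
elim: k A => [|k IHk] A homA leA.
  by exists A; rewrite // /row_free eqn_leq rank_leq_row -(addn0 (\rank A)).
have [le_nA | lt_An] := leqP n1 (\rank A).
  by apply: (IHk A); rewrite ?(leq_trans le_nA) ?leq_addr.
have [A' homA' ltAA'] := intertwiner_rank_lt homA eq_tr lt_An.
by apply: (IHk A' homA'); rewrite (leq_trans leA) // addnS -addSn leq_add2r.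
Qed.

End Enlarge.

End TraceDeterminesRepresentation.

(** * Irreducible characters of p-groups are monomial *)

Section Monomial.

Local Open Scope ring_scope.

Variables (gT : finGroupType) (p : nat).

(** Let K be the kernel of chi and A / K a maximal normal abelian subgroup of
    G / K, so that A / K is self-centralizing.  The constituents of chi on A are
    linear.  If one of them were G-invariant, A would act by scalars, A / K would
    be central, hence equal to G / K, and chi would be linear.  So its inertia
    group is proper, and the Clifford correspondence applies. *)
Lemma pgroup_nonlinear_induced (G : {group gT}) (i : Iirr G) :
    p.-group G -> 'chi_i \isn't a linear_char ->
  exists (T : {group gT}) (j : Iirr T), T \proper G /\ 'chi_i = 'Ind[G] 'chi_j.
Proof.
move=> pG nonlin; pose K := cfker 'chi_i.
have nsKG : K <| G := cfker_normal 'chi_i.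
have [Ab maxAb] : {Ab : {group coset_of K} | [max Ab | Ab <| G / K & abelian Ab]}%g.
  by apply: ex_maxgroup; exists 1%G; rewrite normal1 abelian1.
have pGK : (p.-group (G / K))%g by rewrite quotient_pgroup.
have scnAb := max_SCN pGK maxAb.
have /SCN_P[nsAb cAb] := scnAb; have abAb := SCN_abelian scnAb.
have [A defAb sKA nsAG] := inv_quotientN nsKG nsAb.
have sAG := normal_sub nsAG; have nKA := subset_trans sAG (normal_norm nsKG).
have [j ResAj] := constt_cfRes_irr A i.
have lin_j : 'chi_j \is a linear_char.
  rewrite lin_irr_der1 (subset_trans _ (cfker_constt _ ResAj)) ?cfRes_char ?irr_char //.
  rewrite cfker_Res ?irr_char // subsetI der_sub /=.
  by rewrite der1_min // -defAb.
pose T := 'I_G['chi_j]%G.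
have [defT | neTG] := eqVneq T G.
  case/negP: nonlin; rewrite lin_irr_der1.
  have [sAZ | ] := boolP (A \subset 'Z('chi_i)%CF).
    rewrite der1_min ?normal_norm //.
    suffices defGK : (G / K)%g = Ab by rewrite -/K defGK.
    rewrite -[RHS]cAb; apply/esym/setIidPl.
    rewrite centsC defAb (subset_trans (quotientS _ sAZ)) //.
    by rewrite cfcenter_eq_center subsetIr.
  case/subsetPn=> a Aa /negP[]; rewrite irr_cfcenterE ?(subsetP sAG) //.
  have ResA : 'Res[A] 'chi_i = '['Res[A] 'chi_i, 'chi_j] *: 'chi_j.
    rewrite {1}(Clifford_Res_sum_cfclass nsAG ResAj) cfclass_invariant ?big_seq1 //.
    by rewrite -{1}[gval G](congr1 (@gval _) defT) subsetIr.
  rewrite -(cfResE 'chi_i sAG Aa) -(cfRes1 A) ResA !cfunE normrM.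
  rewrite normC_lin_char // lin_char1 // !mulr1 ger0_norm //.
  by rewrite natr_ge0 ?Cnat_cfdot_char ?cfRes_char ?irr_char.
have [irrInd _ imInd _ _] := constt_Inertia_bijection j nsAG.
have /imsetP[s As def_i] : i \in [set Ind_Iirr G s | s in irr_constt ('Ind[T] 'chi_j)].
  by rewrite imInd constt_Ind_Res.
exists T, s; split; last by rewrite def_i cfIirrE ?irrInd.
rewrite properE subsetIl; apply: contra neTG => sGT.
by rewrite -val_eqE eqEsubset subsetIl.
Qed.

Lemma pgroup_irr_monomial (G : {group gT}) (i : Iirr G) : p.-group G ->
  exists (T : {group gT}) (lambda : 'CF(T)),
    [/\ T \subset G, lambda \is a linear_char & 'chi_i = 'Ind[G] lambda].
Proof.
have [n] := ubnP #|G|; elim: n => // n IHn in G i * => leGn pG.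
have [lin_i | nlin_i] := boolP ('chi_i \is a linear_char).
  by exists G, 'chi_i; rewrite cfInd_id.
have [T [j [ltTG ->]]] := pgroup_nonlinear_induced pG nlin_i.
have sTG := proper_sub ltTG.
have [||U [lambda [sUT lin ->]]] := IHn T j.
- exact: leq_trans (proper_card ltTG) leGn.
- exact: pgroupS pG.
exists U, lambda; split=> //; first exact: subset_trans sTG.
by rewrite cfIndInd.
Qed.

End Monomial.

(** * Recovering a class function from its averages over cyclic subgroups *)

Section RationalTransform.

Local Open Scope ring_scope.

Variables (gT : finGroupType) (p : nat).
Hypothesis p_pr : prime p.

Lemma cycle_expg_coprime (x : gT) k :
  p.-elt x -> ~~ (p %| k)%N -> <[x ^+ k]>%g = <[x]>%g.
Proof.
move=> px p'k; apply/esym/eqP; rewrite -/(generator _ _) generator_coprime.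
by rewrite (pnat_coprime px) // p'natE.
Qed.

(** Every element of H outside L lies in exactly one subgroup K with K / L of
    order p, namely the one generated by L and that element. *)
Lemma big_rank2_quotient (L H : {group gT}) (g : gT -> rat) :
    L <| H -> p.-abelem (H / L)%g ->
  \sum_(x in H) g x = \sum_(x in L) g x
    + \sum_(K : {group gT} | [&& L \subset K, K \subset H & #|(K / L)%g| == p])
        (\sum_(x in K) g x - \sum_(x in L) g x).
Proof.
move=> nsLH abHL; have [sLH nLH] := andP nsLH.
have splitL (K : {group gT}) : L \subset K ->
    \sum_(x in K) g x = \sum_(x in L) g x + \sum_(x in K :\: L) g x.
  by move=> sLK; rewrite (big_setID L) /= (setIidPr sLK).
rewrite (splitL H) //; congr (_ + _).
rewrite (eq_bigr (fun K : {group gT} => \sum_(x in K :\: L) g x)); last first.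
  by move=> K /and3P[sLK _ _]; rewrite splitL // addrC addKr.
rewrite (exchange_big_dep (mem (H :\: L))) /=; last first.
  by move=> K x /and3P[_ sKH _]; apply/subsetP/setSD.
apply: eq_bigr => x /setDP[Hx nLx].
have nLx' : x \in 'N(L) by apply: (subsetP nLH).
rewrite (big_pred1 (L <*> <[x]>)%G) // => K /=.
have sK0H : L <*> <[x]> \subset H by rewrite join_subG sLH cycle_subG.
have cK0 : #|(L <*> <[x]> / L)%g| = p.
  rewrite quotientYidl ?cycle_subG // quotient_cycle //.
  rewrite -orderE (abelem_order_p abHL) ?mem_quotient //.
  by apply: contra nLx => /eqP/coset_idr->.
apply/idP/eqP => [/andP[/and3P[sLK sKH /eqP cK]] | ->].
  rewrite inE => /andP[_ Kx].
  have sK0K : L <*> <[x]> \subset K by rewrite join_subG sLK cycle_subG.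
  apply/esym/val_inj/(quotient_inj (H := L)) => /=.
  - by apply: normalS sK0H nsLH; rewrite joing_subl.
  - exact: normalS sKH nsLH.
  by apply/eqP; rewrite eqEcard quotientS // cK cK0 /=.
rewrite /= joing_subl sK0H cK0 eqxx inE nLx /=.
by rewrite mem_gen // inE cycle_id orbT.
Qed.

(** H / Phi(H) is elementary abelian, and of rank at least 2 unless H is cyclic. *)
Lemma noncyclic_rank2_quotient (H : {group gT}) : p.-group H -> ~~ cyclic H ->
  exists L : {group gT}, [/\ L <| H, p.-abelem (H / L)%g & #|(H / L)%g| = (p ^ 2)%N].
Proof.
move=> pH ncycH; pose Hb := (H / 'Phi(H))%G.
have abHb : p.-abelem Hb by apply: Phi_quotient_abelem.
have pHb := abelem_pgroup abHb.
have le2 : (2 <= logn p #|Hb|)%N.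
  rewrite ltnNge; apply: contra ncycH => le1; apply: Phi_quotient_cyclic.
  by rewrite (abelem_cyclic abHb).
have [Lb [_ nsLb cLb]] := normal_pgroup pHb (normal_refl Hb) (leq_subr 2 _).
have [L defL sPL nsL] := inv_quotientN (Phi_normal H) nsLb.
have isoHL := third_isog sPL (Phi_normal H) nsL.
exists L; split=> //.
  by rewrite -(isog_abelem isoHL) quotient_abelem.
rewrite -(card_isog isoHL) -defL card_quotient ?normal_norm // -divgS ?normal_sub //.
have := card_pgroup pHb; rewrite cLb; move: (logn p _) le2 => m le2 ->.
by rewrite -expnB ?prime_gt0 ?leq_subr // subKn.
Qed.

Lemma abelem_p2_isog_ZpZp (rT : finGroupType) (E : {group rT}) :
  p.-abelem E -> #|E| = (p ^ 2)%N -> E \isog [set: 'Z_p * 'Z_p].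
Proof.
move=> abE cE; have p1 := prime_gt1 p_pr.
rewrite (isog_abelem_card _ abE); apply/andP; split; last first.
  by rewrite cE cardsT card_prod card_ord Zp_cast // mulnn.
have mulE (u v : 'Z_p * 'Z_p) : (u * v)%g = (u.1 + v.1, u.2 + v.2) by [].
apply/abelemP => //; split=> [|x _].
  by apply/centsP=> u _ v _; rewrite /commute !mulE addrC (addrC u.2).
have expE k : (x ^+ k)%g = (x.1 *+ k, x.2 *+ k).
  by elim: k => // k IHk; rewrite expgS IHk mulE !mulrS.
have Zp0 (u : 'Z_p) : u *+ p = 0 by rewrite -mulr_natr pchar_Zp ?mulr0.
by rewrite expE !Zp0.
Qed.

Variable f : {group gT} -> int.

(** For x = 1 the two cyclic subgroups coincide and the formula gives f 1, so it
    is uniform in x. *)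
Definition rational_transform (x : gT) : rat :=
  (p%:R * (f <[x]>)%:~R - (f <[x ^+ p]>)%:~R) / (p%:R - 1).

Local Notation phi := rational_transform.

Lemma p_sub1_neq0 : p%:R - 1 != 0 :> rat.
Proof. by rewrite subr_eq0 (eqr_nat _ p 1) gtn_eqF ?prime_gt1. Qed.

Lemma rational_transform_coprime x k :
  p.-elt x -> ~~ (p %| k)%N -> phi (x ^+ k) = phi x.
Proof.
move=> px p'k; congr ((_ * (f _)%:~R - (f _)%:~R) / _); apply: val_inj => /=.
  exact: cycle_expg_coprime.
by rewrite expgAC; apply: cycle_expg_coprime; rewrite // p_eltX.
Qed.

Lemma rational_transform_conj (S : {group gT}) x y :
    super_class_function S f -> x \in S -> y \in S -> phi (x ^ y) = phi x.
Proof.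
move=> fJ Sx Sy; rewrite /phi -conjXg.
have fJc z : z \in S -> f <[z ^ y]>%G = f <[z]>%G.
  move=> Sz; rewrite -(fJ <[z]>%G y) ?cycle_subG //.
  by congr f; apply: val_inj; rewrite /= cycleJ.
by rewrite !fJc ?groupX.
Qed.

Lemma order_expg_p (x : gT) :
  p.-elt x -> x != 1%g -> #[x] = (p * #[x ^+ p])%N.
Proof.
move=> px ntx; have ntX : <[x]>%g != 1%g by rewrite cycle_eq1.
by have [_ p_dv _] := pgroup_pdiv px ntX; rewrite orderXdiv // mulnC divnK.
Qed.

(** The elements of <x> outside <x^p> are exactly the generators of <x>, and there
    are (p - 1) #[x^p] of them. *)
Lemma sum_rational_transform_cycle x : p.-elt x -> x != 1%g ->
  \sum_(y in <[x]>%g) phi y - \sum_(y in <[x ^+ p]>%g) phi y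
  = #[x]%:R * (f <[x]>)%:~R - #[x ^+ p]%:R * (f <[x ^+ p]>)%:~R.
Proof.
move=> px ntx; have cx := order_expg_p px ntx.
have sDx : <[x ^+ p]>%g \subset <[x]>%g by rewrite cycle_subG mem_cycle.
rewrite [X in X - _](big_setID <[x ^+ p]>%g) /= (setIidPr sDx) addrAC subrr add0r.
rewrite (eq_bigr (fun=> phi x)) => [|y /setDP[/cycleP[k ->] nDy]]; last first.
  apply: rational_transform_coprime => //; apply: contra nDy => /dvdnP[m ->].
  by rewrite mulnC expgM mem_cycle.
rewrite sumr_const cardsD (setIidPr sDx) -!orderE cx.
rewrite -[phi x *+ _]mulr_natl natrB; last first.
  by rewrite leq_pmull ?prime_gt0.
rewrite natrM /phi; field; exact: p_sub1_neq0.
Qed.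

(** For noncyclic H, the Borel-Smith condition reads p f H = \sum_K f K - f L. *)
Lemma sum_rational_transform (S H : {group gT}) :
    p.-group S -> borel_smith S f -> H \subset S ->
  \sum_(x in H) phi x = #|H|%:R * (f H)%:~R.
Proof.
move=> pS [_ _ bs _]; have [n] := ubnP #|H|; elim: n => // n IHn in H *.
rewrite ltnS => leHn sHS; have pH := pgroupS sHS pS.
have [/cyclicP[x defH] | ncycH] := boolP (cyclic H).
  have {}defH : H = <[x]>%G by apply: val_inj.
  rewrite {H}defH in leHn sHS pH *.
  have [-> | ntx] := eqVneq x 1%g.
    rewrite /= cycle1 big_set1 cards1 mul1r /phi expg1n.
    by rewrite -[X in _ - X]mul1r -mulrBl mulrAC mulfV ?mul1r ?p_sub1_neq0.
  have /eqP := sum_rational_transform_cycle pH ntx.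
  rewrite (IHn <[x ^+ p]>%G) ?(subr_eq _ _ (_ * _)) ?subrK => [/eqP // | | ].
    rewrite (leq_trans _ leHn) //= -!orderE (order_expg_p pH ntx).
    by rewrite ltn_Pmull ?prime_gt1.
  by rewrite cycle_subG groupX // -cycle_subG.
have [L [nsLH abHL cHL]] := noncyclic_rank2_quotient pH ncycH.
have sLH := normal_sub nsLH; have nLH := normal_norm nsLH.
have cH : #|H| = (p ^ 2 * #|L|)%N.
  by rewrite -cHL card_quotient // mulnC Lagrange.
have cK (K : {group gT}) : L \subset K -> K \subset H -> #|(K / L)%g| == p ->
    #|K| = (p * #|L|)%N.
  move=> sLK sKH /eqP <-.
  by rewrite card_quotient ?(subset_trans sKH) // mulnC Lagrange.
have p1 := prime_gt1 p_pr.
set Ks := fun K : {group gT} => [&& L \subset K, K \subset H & #|(K / L)%g| == p].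
have fBS : (f L)%:~R - (f H)%:~R = \sum_(K | Ks K) ((f K)%:~R - (f H)%:~R) :> rat.
  rewrite -intrB (bs p L H) //; last exact: abelem_p2_isog_ZpZp.
  rewrite rmorph_sum.
  by apply: eq_bigr => K _; rewrite rmorphB.
(* Counting H gives the number of subgroups K: p^2 = 1 + #K (p - 1). *)
have cKs : \sum_(K | Ks K) 1 = p%:R + 1 :> rat.
  have nzl : (p%:R - 1) * #|L|%:R != 0 :> rat.
    by rewrite mulf_neq0 ?p_sub1_neq0 // pnatr_eq0 -lt0n.
  have := big_rank2_quotient (fun=> 1) nsLH abHL; rewrite -/Ks.
  rewrite [X in _ + X](eq_bigr (fun=> (p%:R - 1) * #|L|%:R * 1))
    => [|K /and3P[sLK sKH cKL]].
    rewrite -mulr_sumr; set s := \sum_(K | Ks K) 1; rewrite !sumr_const => cnt.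
    apply: (mulfI nzl); rewrite -[LHS](addKr #|L|%:R) -cnt cH natrM natrX; ring.
  by rewrite !sumr_const (cK K) // natrM; ring.
rewrite (big_rank2_quotient phi nsLH abHL) -/Ks.
rewrite IHn ?(subset_trans sLH) //; last first.
  by rewrite (leq_trans _ leHn) // cH ltn_Pmull // -{1}(exp1n 2) ltn_exp2r.
(* The final factor 1 lets the part independent of K be summed by cKs. *)
rewrite (eq_bigr (fun K : {group gT} =>
  #|L|%:R * (p%:R * ((f K)%:~R - (f H)%:~R)
    + (p%:R * (f H)%:~R - (f L)%:~R) * 1))); last first.
  move=> K /and3P[sLK sKH cKL]; rewrite IHn ?(subset_trans sKH) //.
    by rewrite (cK K) // natrM; ring.
  rewrite (leq_trans _ leHn) // cH (cK K) //.
  by rewrite ltn_pmul2r // -{1}(expn1 p) ltn_exp2l.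
rewrite -mulr_sumr big_split /= -!mulr_sumr cKs -fBS cH natrM natrX.
ring.
Qed.

End RationalTransform.

(** * The cone of rationally afforded functions *)

Section RationalCone.

Local Open Scope ring_scope.

Variables (gT : finGroupType) (S : {group gT}).

Definition rationally_afforded (g : gT -> rat) : Prop :=
  exists (N : nat) (W : representation rat S),
    (0 < N)%N /\ {in S, forall x, \tr (W x) = N%:R * g x}.

Lemma mxtrace_dadd (W1 W2 : representation rat S) x :
  \tr (dadd_grepr W1 W2 x) = \tr (W1 x) + \tr (W2 x).
Proof. exact: mxtrace_block. Qed.

Lemma mxtrace_muln (W : representation rat S) k x :
  \tr (muln_grepr W k x) = k%:R * \tr (W x).
Proof.
rewrite /muln_grepr; elim: k => [|k IHk].
  by rewrite big_ord0 mul0r /= mxtrace1.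
by rewrite big_ord_recl mxtrace_dadd IHk -addn1 natrD mulrDl mul1r addrC.
Qed.

Lemma rationally_afforded0 : rationally_afforded (fun=> 0).
Proof. by exists 1%N, grepr0; split=> // x _; rewrite mulr0 /= mxtrace1. Qed.

Lemma rationally_affordedD g h : rationally_afforded g -> rationally_afforded h ->
  rationally_afforded (fun x => g x + h x).
Proof.
move=> [N [W [N0 trW]]] [M [U [M0 trU]]].
exists (N * M)%N, (dadd_grepr (muln_grepr W M) (muln_grepr U N)).
split=> [|x Sx]; first by rewrite muln_gt0 N0.
by rewrite mxtrace_dadd !mxtrace_muln trW // trU // natrM; ring.
Qed.

Lemma rationally_affordedZ g (r : rat) : 0 <= r ->
  rationally_afforded g -> rationally_afforded (fun x => r * g x).
Proof.
move=> r0 [N [W [N0 trW]]].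
have [n rn] : exists n : nat, numq r = n.
  by exists `|numq r|%N; rewrite gez0_abs // numq_ge0.
have [d rd] : exists d : nat, denq r = d.
  by exists `|denq r|%N; rewrite gez0_abs // denq_ge0.
have d0 : (0 < d)%N by rewrite -ltz_nat -rd denq_gt0.
exists (N * d)%N, (muln_grepr W n); split=> [|x Sx]; first by rewrite muln_gt0 N0.
rewrite mxtrace_muln trW // natrM -[r in RHS]divq_num_den rn rd !pmulrn.
by field; rewrite pnatr_eq0 -lt0n.
Qed.

Lemma rationally_afforded_sum (I : finType) (g : I -> gT -> rat) :
    (forall i, rationally_afforded (g i)) ->
  rationally_afforded (fun x => \sum_i g i x).
Proof.
move=> affg; elim: (index_enum I) => [|i r [N [W [N0 trW]]]].
  have [N [W [N0 trW]]] := rationally_afforded0.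
  by exists N, W; split=> // x Sx; rewrite big_nil trW.
have := rationally_affordedD (affg i) (ex_intro _ N (ex_intro _ W (conj N0 trW))).
case=> M [U [M0 trU]]; exists M, U; split=> // x Sx.
by rewrite big_cons trU.
Qed.

End RationalCone.

(** * Averages over the power maps with exponent prime to p *)

Section PrimePowerAverage.

Local Open Scope ring_scope.

Variable p : nat.
Hypothesis p_pr : prime p.

(** The sum of F over the exponents below p q that are prime to p, written as
    i + p j with 0 < i < p so that the inner sums are geometric. *)
Definition unit_power_sum (R : nmodType) (q : nat) (F : nat -> R) : R :=
  \sum_(i < p.-1) \sum_(j < q) F (i.+1 + p * j)%N.

Lemma unit_power_sum_eq (R : nmodType) q (F G : nat -> R) :
  (forall k, ~~ (p %| k)%N -> F k = G k) -> unit_power_sum q F = unit_power_sum q G.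
Proof.
move=> eqFG; apply: eq_bigr => i _; apply: eq_bigr => j _; apply: eqFG.
have lt_ip : (i.+1 < p)%N by rewrite -[X in (_ < X)%N](prednK (prime_gt0 p_pr)) ltnS.
by rewrite dvdn_addl ?dvdn_mulr // gtnNdvd.
Qed.

Lemma unit_power_sum_const (R : pzSemiRingType) q (c : R) :
  unit_power_sum q (fun=> c) = (p.-1 * q)%:R * c.
Proof.
rewrite /unit_power_sum sumr_const sumr_const !card_ord -mulrnA.
by rewrite mulr_natl mulnC.
Qed.

Lemma sum_unity_root (R : idomainType) (w : R) n :
  w ^+ n = 1 -> \sum_(j < n) w ^+ j = n%:R * (w == 1)%:R.
Proof.
move=> wn1; have [->|nw1] := eqVneq w 1.
  by under eq_bigr => j _ do rewrite expr1n; rewrite sumr_const card_ord mulr1.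
rewrite mulr0; apply: (mulfI (x := w - 1)); first by rewrite subr_eq0.
by rewrite -subrX1 wn1 subrr mulr0.
Qed.

Lemma unit_power_sum_unity_root (R : idomainType) (z : R) q : z ^+ (p * q) = 1 ->
  unit_power_sum q (fun k => z ^+ k)
    = q%:R * (p%:R * (z == 1)%:R - (z ^+ p == 1)%:R).
Proof.
move=> zpq1; rewrite /unit_power_sum.
under eq_bigr => i _.
  under eq_bigr => j _ do rewrite exprD exprM.
  rewrite -mulr_sumr sum_unity_root -?exprM // mulrCA.
over.
rewrite -mulr_sumr -mulr_suml; congr (_ * _).
have [zp1 | nzp1] := eqVneq (z ^+ p) 1; last first.
  rewrite mulr0; have [z1|_] := eqVneq z 1; first by rewrite z1 expr1n eqxx in nzp1.
  by rewrite mulr0 subrr.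
rewrite mulr1 -(sum_unity_root zp1) -[in RHS](prednK (prime_gt0 p_pr)).
by rewrite big_ord_recl expr0 addrC addKr.
Qed.

End PrimePowerAverage.

Section LinearCharacterAverage.

Local Open Scope ring_scope.

Variables (gT : finGroupType) (p : nat) (T : {group gT}) (lambda : 'CF(T)).
Hypotheses (p_pr : prime p) (pT : p.-group T).
Hypothesis lin : lambda \is a linear_char.

Local Notation P := (cfker lambda).
Local Notation Q := (cfker (lambda ^+ p)).

(** On a p-group, x |-> x ^ k is a permutation when k is prime to p. *)
Lemma sum_coprime_power (R : nmodType) (g : gT -> R) k : ~~ (p %| k)%N ->
  \sum_(x in T) g (x ^+ k)%g = \sum_(x in T) g x.
Proof.
move=> p'k; have coTk : coprime #|T| k by rewrite (pnat_coprime pT) // p'natE.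
pose h (x : gT) := (x ^+ expg_invn T k)%g.
rewrite [RHS](reindex_onto (fun x => x ^+ k)%g h) => [|x Tx]; last first.
  by rewrite /h expgAC; apply: (expgK coTk).
apply: eq_bigl => x; apply/idP/andP => [Tx | [Txk /eqP <-]].
  by rewrite groupX //; split=> //; rewrite /h (expgK coTk).
exact: groupX.
Qed.

Lemma mem_cfker_lin (xi : 'CF(T)) x :
  xi \is a linear_char -> x \in T -> (x \in cfker xi) = (xi x == 1).
Proof. by move=> lxi Tx; rewrite cfkerEchar ?lin_charW // inE Tx lin_char1. Qed.

Lemma lin_power_average q w : w \in T -> (#|T| %| q)%N ->
  unit_power_sum p q (fun k => lambda (w ^+ k)%g)
    = q%:R * (p%:R * (w \in P)%:R - (w \in Q)%:R).
Proof.
move=> Tw dvTq; rewrite !mem_cfker_lin ?rpredX // exp_cfunE //.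
rewrite -unit_power_sum_unity_root //.
  by apply: unit_power_sum_eq => // k _; rewrite lin_charX.
rewrite -lin_charX // -(lin_char1 lin); congr (lambda _).
by apply/eqP; rewrite -order_dvdn dvdn_mull // (dvdn_trans (order_dvdG Tw)).
Qed.

(** A power-invariant g does not distinguish lambda from its average, which is a
    combination of the indicators of P and Q. *)
Lemma lin_power_invariant_pairing (g : gT -> algC) :
    (forall x k, x \in T -> ~~ (p %| k)%N -> g (x ^+ k)%g = g x) ->
  p.-1%:R * \sum_(x in T) g x * (lambda x)^*
    = p%:R * \sum_(x in P) g x - \sum_(x in Q) g x.
Proof.
move=> gX; pose q := #|T|; have nzq : q%:R != 0 :> algC by apply: neq0CG.
have avg : unit_power_sum p q (fun k => \sum_(x in T) g x * (lambda (x ^+ k)%g)^*)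
    = (p.-1 * q)%:R * \sum_(x in T) g x * (lambda x)^*.
  rewrite -unit_power_sum_const; apply: unit_power_sum_eq => // k p'k.
  rewrite -[RHS](sum_coprime_power _ p'k).
  by apply: eq_bigr => x Tx; rewrite gX.
apply: (mulfI nzq); rewrite mulrA -natrM mulnC -avg.
transitivity (\sum_(x in T) g x * (unit_power_sum p q (fun k => lambda (x ^+ k)%g))^*).
  rewrite /unit_power_sum.
  under eq_bigr do rewrite exchange_big /=.
  rewrite exchange_big; apply: eq_bigr => x _.
  rewrite rmorph_sum mulr_sumr; apply: eq_bigr => i _.
  by rewrite rmorph_sum mulr_sumr.
have sumK (xi : 'CF(T)) :
  \sum_(x in cfker xi) g x = \sum_(x in T) g x * (x \in cfker xi)%:R.
  rewrite [LHS]big_mkcond [RHS]big_mkcond; apply: eq_bigr => x _ /=.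
  case: ifP => [/(subsetP (cfker_sub xi)) -> | _]; first by rewrite mulr1.
  by rewrite mulr0 if_same.
rewrite !sumK mulr_sumr -sumrB mulr_sumr; apply: eq_bigr => x Tx.
rewrite lin_power_average //.
rewrite rmorphM rmorphB rmorphM !rmorph_nat.
by ring.
Qed.

(** The pairing formula with g = 1, where the left-hand side vanishes by
    orthogonality to the trivial character. *)
Lemma card_cfker_expp : lambda != 1 -> #|Q| = (p * #|P|)%N.
Proof.
move=> nt; have /irrP[j def_j] := lin_char_irr lin.
have := lin_power_invariant_pairing (g := fun=> 1) (fun _ _ _ _ => erefl).
have -> : \sum_(x in T) 1 * (lambda x)^* = 0.
  have : '[1, lambda] = 0.
    by rewrite def_j -irr0 cfdot_irr eq_sym -irr_eq1 -def_j (negPf nt).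
  rewrite cfdotE => /eqP; rewrite mulf_eq0 invr_eq0 (negPf (neq0CG T)) /= => /eqP sum0.
  by rewrite -[RHS]sum0; apply: eq_bigr => x Tx; rewrite cfun1E Tx.
by rewrite mulr0 !sumr_const => /esym/eqP; rewrite subr_eq0 -natrM eqC_nat => /eqP.
Qed.

End LinearCharacterAverage.

(** * A multiple of the transform is a rational character *)

Section Realization.

Local Open Scope ring_scope.

Variables (gT : finGroupType) (p : nat) (S : {group gT}) (f : {group gT} -> int).
Hypotheses (p_pr : prime p) (pS : p.-group S).
Hypotheses (bsf : borel_smith S f) (monof : monotone_on S f).

Local Notation phi := (rational_transform p f).

Fact transform_cfun_subproof :
  is_class_fun <<S>>%g [ffun x => ratr (phi x) *+ (x \in S) : algC].
Proof.
rewrite genGid; apply: intro_class_fun => [x y Sx Sy | x /negPf->//].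
case: bsf => fJ _ _ _.
by rewrite groupJr // (rational_transform_conj p fJ).
Qed.

Definition transform_cfun : 'CF(S) := Cfun 0 transform_cfun_subproof.

Lemma transform_cfunE x : x \in S -> transform_cfun x = ratr (phi x).
Proof. by move=> Sx; rewrite cfunE Sx. Qed.

Lemma sum_transform_cfun (H : {group gT}) : H \subset S ->
  \sum_(x in H) transform_cfun x = #|H|%:R * (f H)%:~R.
Proof.
move=> sHS; rewrite (eq_bigr (fun x => ratr (phi x))) => [|x Hx]; last first.
  by rewrite transform_cfunE ?(subsetP sHS).
rewrite -rmorph_sum (sum_rational_transform p_pr pS bsf sHS).
by rewrite rmorphM rmorph_nat rmorph_int.
Qed.

Lemma Ind_lin_power_average (T : {group gT}) (lambda : 'CF(T)) y :
    T \subset S -> lambda \is a linear_char -> y \in S ->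
  unit_power_sum p #|S| (fun k => ('Ind[S] lambda) (y ^+ k)%g)
    = #|S|%:R / #|T|%:R * (p%:R * \sum_(u in S) ((y ^ u)%g \in cfker lambda)%:R
        - \sum_(u in S) ((y ^ u)%g \in cfker (lambda ^+ p))%:R).
Proof.
move=> sTS lin Sy; have pT := pgroupS sTS pS.
transitivity (#|T|%:R^-1 * \sum_(u in S)
    unit_power_sum p #|S| (fun k => lambda ((y ^ u) ^+ k)%g)).
  rewrite /unit_power_sum.
  under eq_bigr do under eq_bigr do rewrite cfIndE //.
  under eq_bigr do rewrite -mulr_sumr exchange_big /=.
  rewrite -mulr_sumr exchange_big /=; congr (_ * _); apply: eq_bigr => u _.
  by apply: eq_bigr => i _; apply: eq_bigr => j _; rewrite conjXg.
rewrite [_ / _]mulrC -mulrA; congr (_ * _).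
rewrite mulr_sumr -sumrB mulr_sumr; apply: eq_bigr => u Su.
have [Tyu | nTyu] := boolP ((y ^ u)%g \in T).
  by rewrite (lin_power_average p_pr lin) ?cardSg.
have out (xi : 'CF(T)) : ((y ^ u)%g \in cfker xi) = false.
  by apply: contraNF nTyu; apply/subsetP/cfker_sub.
rewrite !out mulr0 subr0 mulr0 (@unit_power_sum_eq _ p_pr _ _ _ (fun=> 0)).
  by rewrite unit_power_sum_const mulr0.
move=> k p'k; rewrite cfun0 // -cycle_subG (cycle_expg_coprime p_pr) ?cycle_subG //.
by rewrite (mem_p_elt pS) // groupJ.
Qed.

(** The contribution of chi_i to the average of phi over the power maps.  If
    chi_i = Ind lambda with lambda nontrivial, then #|Q| = p #|P| makes it a
    multiple of Ind 1_P - Ind 1_Q with a coefficient of the sign of f P - f Q;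
    if lambda = 1 then P = Q = T and it is f T times Ind 1_T. *)
Lemma irr_contribution (i : Iirr S) : exists g : gT -> rat,
  rationally_afforded S g /\
  {in S, forall y, '[transform_cfun, 'chi_i]
      * unit_power_sum p #|S| (fun k => 'chi_i (y ^+ k)%g)
    = (p.-1 * #|S|)%:R * ratr (g y)}.
Proof.
have [T [lambda [sTS lin ->]]] := pgroup_irr_monomial i pS.
have pT := pgroupS sTS pS.
have nzT : #|T|%:R != 0 :> algC := neq0CG T.
have nzp : p.-1%:R != 0 :> algC.
  by rewrite pnatr_eq0 -lt0n -ltnS prednK ?prime_gt1 ?prime_gt0.
pose P := [group of cfker lambda]; pose Q := [group of cfker (lambda ^+ p)].
have sPT : P \subset T := cfker_sub _; have sQT : Q \subset T := cfker_sub _.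
have sPS := subset_trans sPT sTS; have sQS := subset_trans sQT sTS.
have ratr_cfind1 (H : {group gT}) y :
    \sum_(u in S) ((y ^ u)%g \in H)%:R = #|H|%:R * ratr (cfind1 S H y) :> algC.
  rewrite rmorphM fmorphV rmorph_nat rmorph_sum mulVKf ?neq0CG //.
  by apply: eq_bigr => u _; rewrite rmorph_nat.
have coef : p.-1%:R * #|T|%:R * '[transform_cfun, 'Ind[S] lambda]
    = p%:R * (#|P|%:R * (f P)%:~R) - #|Q|%:R * (f Q)%:~R.
  rewrite -cfdot_Res_l cfdotE mulrA mulfK //.
  have -> : \sum_(x in T) 'Res[T] transform_cfun x * (lambda x)^*
      = \sum_(x in T) transform_cfun x * (lambda x)^*.
    by apply: eq_bigr => x Tx; rewrite cfResE.
  rewrite lin_power_invariant_pairing // => [|x k Tx p'k].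
    by rewrite (sum_transform_cfun sPS) (sum_transform_cfun sQS).
  have Sx := subsetP sTS x Tx; rewrite !transform_cfunE ?groupX //.
  by rewrite rational_transform_coprime // (mem_p_elt pT).
have [lam1 | nt_lam] := eqVneq lambda 1.
  have kerT n : cfker (lambda ^+ n) = T by rewrite lam1 expr1n cfker_cfun1.
  exists (fun y => (f T)%:~R * cfind1 S T y); split=> [|y Sy].
    have [W trW] := cfind1_repr sTS.
    apply: rationally_affordedZ; last first.
      by exists 1%N, W; split=> // x /trW->; rewrite mul1r.
    by rewrite ler0z; have /andP[] := monof (subxx T) sTS.
  have defP : P = T by apply: val_inj; rewrite /= -[lambda]expr1 kerT.
  have defQ : Q = T by apply: val_inj; rewrite /= kerT.
  rewrite Ind_lin_power_average // !(ratr_cfind1 P, ratr_cfind1 Q).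
  move: coef; rewrite defP defQ => coef.
  move: (cfind1 S T y) => c; rewrite [ratr (_ * _)]rmorphM /= ratr_int.
  apply: (mulfI (mulf_neq0 nzp nzT)); rewrite [LHS]mulrA coef.
  have -> : p%:R = p.-1%:R + 1 :> algC.
    by rewrite -(natrD _ _ 1) addn1 prednK ?prime_gt0.
  by rewrite natrM; field.
have sPQ : P \subset Q.
  apply/subsetP=> x Px; have Tx := subsetP sPT x Px.
  move: Px; rewrite /= !mem_cfker_lin ?rpredX // exp_cfunE // => /eqP->.
  by rewrite expr1n.
have cQ : #|Q| = (p * #|P|)%N := card_cfker_expp p_pr pT lin nt_lam.
pose r : rat := (#|Q|%:R / (p.-1%:R * #|T|%:R)) ^+ 2 * ((f P)%:~R - (f Q)%:~R).
exists (fun y => r * (cfind1 S P y - cfind1 S Q y)); split=> [|y Sy].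
  have [W trW] := cfind1_diff_repr sPQ sQS.
  apply: rationally_affordedZ; last first.
    by exists 1%N, W; split=> // x /trW->; rewrite mul1r.
  rewrite mulr_ge0 ?exprn_even_ge0 // subr_ge0 ler_int.
  by have /andP[] := monof sPQ sQS.
rewrite Ind_lin_power_average // !(ratr_cfind1 P, ratr_cfind1 Q).
move: (cfind1 S P y) (cfind1 S Q y) => c d /=; rewrite /r.
rewrite !(rmorphM, rmorphB, rmorphXn, fmorphV) /= !ratr_nat !ratr_int.
apply: (mulfI (mulf_neq0 nzp nzT)); rewrite [LHS]mulrA coef cQ !natrM.
by field; rewrite nzp nzT.
Qed.

Lemma rational_transform_afforded : rationally_afforded S phi.
Proof.
have [g Hg] := fin_all_exists irr_contribution.
have [N [W [N0 trW]]] := rationally_afforded_sum (fun i => proj1 (Hg i)).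
exists N, W; split=> // y Sy; rewrite trW //; congr (_ * _).
have nzpq : (p.-1 * #|S|)%:R != 0 :> algC.
  rewrite natrM mulf_neq0 ?neq0CG // pnatr_eq0 -lt0n -ltnS.
  by rewrite prednK ?prime_gt1 ?prime_gt0.
apply: (fmorph_inj (ratr : {rmorphism rat -> algC})); apply: (mulfI nzpq) => /=.
rewrite -transform_cfunE // rmorph_sum mulr_sumr.
under eq_bigr => i _ do rewrite -(proj2 (Hg i)) //.
rewrite -unit_power_sum_const.
transitivity (unit_power_sum p #|S| (fun k => transform_cfun (y ^+ k)%g)); last first.
  apply: unit_power_sum_eq => // k p'k; rewrite !transform_cfunE ?groupX //.
  by rewrite rational_transform_coprime // (mem_p_elt pS).
rewrite /unit_power_sum.
under [RHS]eq_bigr => a _ do under eq_bigr => b _ do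
  rewrite [transform_cfun]cfun_sum_cfdot sum_cfunE.
under [RHS]eq_bigr => a _ do rewrite exchange_big /=.
rewrite exchange_big; apply: eq_bigr => i _.
rewrite mulr_sumr; apply: eq_bigr => a _; rewrite mulr_sumr; apply: eq_bigr => b _.
by rewrite cfunE.
Qed.

End Realization.

(** * Stability under fusion *)

Section FusionInvariance.

Variables (gT : finGroupType) (S : {group gT}) (F : fusion_system S).

Lemma fus_conjugate_restr (P C : {group gT}) (theta : {morphism P >-> gT})
    (sCP : C \subset P) :
    P \subset S -> fus_hom F S theta ->
  fus_conjugate F C (restrm sCP theta @* C)%G.
Proof.
move=> sPS Ftheta; have sCS := subset_trans sCP sPS.
have Fres : fus_hom F S [morphism of restrm sCP theta].
  have Fincl : fus_hom F P [morphism of conjgm C 1].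
    by apply: fus_conj; rewrite ?conjsg1.
  by apply: (fus_comp _ _ _ Fincl Ftheta) => // x Cx; rewrite /= conjgmE conjg1.
have [injres _] := fus_inj sCS (subxx _) Fres.
exists [morphism of restrm sCP theta], [morphism of invm injres]; split.
- exact: fus_img Fres.
- exact: fus_inv Fres.
- exact: invmE.
exact: invmK.
Qed.

Lemma rational_transform_fus_hom p f (P : {group gT}) (theta : {morphism P >-> gT}) x :
    fus_invariant F f -> P \subset S -> fus_hom F S theta -> x \in P ->
  rational_transform p f (theta x) = rational_transform p f x.
Proof.
move=> Ff sPS Ftheta Px.
have fcyc z : z \in P -> f <[theta z]>%G = f <[z]>%G.
  move=> Pz; have sZP : <[z]> \subset P by rewrite cycle_subG.
  have [_ sPi] := fus_inj sPS (subxx _) Ftheta.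
  have defZ : (restrm sZP theta @* <[z]>)%G = <[theta z]>%G.
    by apply: val_inj; rewrite /= morphim_restrm setIid morphim_cycle.
  rewrite -defZ; apply/esym/Ff; last exact: fus_conjugate_restr.
    exact: subset_trans sPS.
  by rewrite defZ cycle_subG (subsetP sPi) ?mem_morphim.
by rewrite /rational_transform -morphX // !fcyc ?groupX.
Qed.

End FusionInvariance.

Theorem theoremB (gT : finGroupType) (p : nat) (S : {group gT})
    (F : fusion_system S) (f : {group gT} -> int) :
  prime p -> p.-group S -> saturated F p ->
  borel_smith S f -> fus_invariant F f -> monotone_on S f ->
  exists (N : nat) (n : nat) (V : mx_representation rat S n),
    [/\ 0 < N, fus_stable F V
      & forall H : {group gT}, H \subset S ->
          Posz (\rank (rfix_mx V H)) = (Posz N * f H)%R].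
Proof.
move=> p_pr pS _ bsf Ff monof.
have [N [W [N0 trW]]] := rational_transform_afforded p_pr pS bsf monof.
exists N, (rdegree W), W; split=> // [P theta sPS Ftheta | H sHS].
  have [_ sPi] := fus_inj sPS (subxx _) Ftheta.
  apply: mx_rsim_of_trace => x Px; have Sx := subsetP sPS x Px.
  rewrite [LHS]trW; last by rewrite (subsetP sPi) ?mem_morphim.
  by rewrite [RHS]trW // (rational_transform_fus_hom p Ff sPS).
apply: (@intr_inj rat).
have nzH : (#|H|%:R != 0 :> rat)%R by rewrite pnatr_eq0 -lt0n cardG_gt0.
apply: (mulfI nzH); rewrite mxrank_rfix // rmorphM /=.
rewrite mulrCA -(sum_rational_transform p_pr pS bsf sHS) mulr_sumr.
by apply: eq_bigr => x Hx; rewrite trW ?(subsetP sHS).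
Qed.
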